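(* Let $\Pi$ be a set of permutations and $n$ a positive integer. If $Q_n(\Pi)$ is symmetric then so is $Q_n(\Pi^c)$. In particular, if $Q_n(\Pi)=\sum_{\lambda}c_\lambda s_\lambda$ (sum over partitions $\lambda$ of $n$) for certain coefficients $c_\lambda$, then $$Q_n(\Pi^c)=\sum_\lambda c_\lambda s_{\lambda^t}.$$
   Context: $\mathfrak{S}_n$ is the set of permutations of $[n]$ in one-line notation. For $\pi=\pi_1\cdots\pi_m\in\mathfrak{S}_m$ the complement is $\pi^c=(m+1-\pi_1)(m+1-\pi_2)\cdots(m+1-\pi_m)$, and $\Pi^c=\{\pi^c\mid\pi\in\Pi\}$. A permutation $\sigma$ contains $\pi$ as a pattern if some (not necessarily consecutive) subsequence of $\sigma$ is order-isomorphic to $\pi$; otherwise it avoids $\pi$. $\mathfrak{S}_n(\Pi)$ is the set of $\sigma\in\mathfrak{S}_n$ avoiding every $\pi\in\Pi$. $\mathrm{Des}\,\sigma=\{i\mid\sigma_i>\sigma_{i+1}\}\subseteq[n-1]$. For $S\subseteq[n-1]$, $F_S=\sum x_{i_1}\cdots x_{i_n}$ over all $i_1\le\dots\le i_n$ with $i_s<i_{s+1}$ whenever $s\in S$. $Q_n(\Pi)=\sum_{\sigma\in\mathfrak{S}_n(\Pi)}F_{\mathrm{Des}\,\sigma}$. $s_\lambda$ is the Schur function and $\lambda^t$ the transpose (conjugate) partition of $\lambda$. *)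

(* Defs.v *)
From HB Require Import structures.
From mathcomp Require Import all_boot all_algebra all_fingroup finmap.
From mathcomp Require Import boolp classical_sets functions cardinality fsbigop.
From mathcomp.multinomials Require Import monalg.

Set Implicit Arguments.
Unset Strict Implicit.
Unset Printing Implicit Defensive.

Import GRing.Theory.

Local Open Scope ring_scope.

(* A permutation p : 'S_m is read in one-line notation with values and
   positions both shifted down by one, i.e. as a permutation of {0, .., m-1}. *)
Definition oneline n (s : 'S_n) : seq nat := [seq val (s i) | i <- enum 'I_n].

Definition perm_compl m (p : 'S_m) : 'S_m :=
  perm (inj_comp (@rev_ord_inj m) (@perm_inj _ p)).

(* An arbitrary, possibly infinite, set of permutations, graded by length. *)
Definition permset := forall m : nat, {set 'S_m}.

Definition permset_compl (Pi : permset) : permset :=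
  fun m => [set perm_compl p | p in Pi m]%SET.

Definition contains n m (s : 'S_n) (p : 'S_m) : bool :=
  [exists f : {ffun 'I_m -> 'I_n},
     [forall i : 'I_m, forall j : 'I_m, (i < j)%N ==> (f i < f j)%N]
     && [forall i : 'I_m, forall j : 'I_m,
           (s (f i) < s (f j))%N == (p i < p j)%N]].

Definition avoiders n (Pi : permset) : {set 'S_n} :=
  [set s : 'S_n | `[< forall m (p : 'S_m), p \in Pi m -> ~~ contains s p >]]%SET.

(* The index k : 'I_n.-1 stands for the element k+1 of [n-1]. *)
Definition Des n (s : 'S_n) : {set 'I_n.-1} :=
  [set k : 'I_n.-1 | nth 0%N (oneline s) k.+1 < nth 0%N (oneline s) k]%N%SET.

(* Formal power series over R in the countably many commuting variables
   x_0, x_1, ...: all functions from monomials to coefficients.  The regular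
   module R^o is only there to make the R-module structure inferable. *)
Notation fpseries R := ({cmonom nat} -> R^o).

(* The monomial x_(u_1) ... x_(u_k) of an index word u. *)
Definition word_monom (u : seq nat) : {cmonom nat} :=
  \big[mmul/mone]_(i <- u) ucm i.

(* The formal infinite sum of the monomials w t, for t in A; it is meaningful
   when each monomial is hit finitely often (see word_fiber_finite and
   ssyt_fiber_finite). *)
Definition monom_sum (R : nzRingType) (T : choiceType) (A : set T)
    (w : T -> {cmonom nat}) : fpseries R :=
  fun m => \sum_(t \in [set t | A t /\ w t = m]%classic) (1 : R).

(* Invariance under all permutations w of the variables: m' below is the
   monomial obtained from m by the substitution x_i |-> x_(w i). *)
Definition symmetric_series (R : nzRingType) (f : fpseries R) : Prop :=
  forall w : nat -> nat, bijective w ->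
  forall m m' : {cmonom nat}, (forall i, m' (w i) = m i) -> f m' = f m.

Definition F_index n (S : {set 'I_n.-1}) (u : seq nat) : Prop :=
  size u = n /\
  forall k : 'I_n.-1,
    (nth 0%N u k <= nth 0%N u k.+1)%N /\
    (k \in S -> (nth 0%N u k < nth 0%N u k.+1)%N).

Definition fundamental (R : nzRingType) n (S : {set 'I_n.-1}) : fpseries R :=
  monom_sum R [set u | F_index S u]%classic word_monom.

Definition Qpat (R : nzRingType) n (Pi : permset) : fpseries R :=
  \sum_(s in avoiders n Pi) fundamental R (Des s).

(* Integer partitions are nonincreasing sequences of positive parts. *)
Definition partitions_of (n : nat) : set (seq nat) :=
  [set la : seq nat |
    [/\ sorted geq la, all (fun k => 0 < k)%N la & sumn la = n]]%classic.

Definition part_transpose (la : seq nat) : seq nat :=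
  mkseq (fun j => count (fun k => j < k)%N la) (head 0%N la).

(* Semistandard Young tableaux of shape la, given by the list of their rows:
   rows weakly increase, columns strictly increase. *)
Definition ssyt (la : seq nat) : set (seq (seq nat)) :=
  [set t : seq (seq nat) |
    [/\ shape t = la, all (sorted leq) t
      & forall i j, (j < size (nth [::] t i.+1))%N ->
          (nth 0%N (nth [::] t i) j < nth 0%N (nth [::] t i.+1) j)%N]]%classic.

Definition schur (R : nzRingType) (la : seq nat) : fpseries R :=
  monom_sum R (ssyt la) (fun t => word_monom (flatten t)).

(* The finitely supported sums \sum_(_ \in _) used here default to 0 on infinite
   supports; the following facts show that this never happens. *)
Section Finiteness.

Local Open Scope nat_scope.
Local Open Scope classical_set_scope.

Lemma word_monomE u i : word_monom u i = count_mem i u.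
Proof.
rewrite /word_monom; elim: u => [|j u IH]; first by rewrite big_nil cm1.
by rewrite big_cons cmM cmU IH /= addnC addnC.
Qed.

Lemma word_fiber_finite m : finite_set [set u | word_monom u = m].
Proof.
case: (pselect (exists v, word_monom v = m)) => [[v vm]|h].
  apply: (sub_finite_set (B := [set` permutations v])).
    move=> u /= um; rewrite mem_permutations; apply/allP => x _ /=.
    by rewrite -!word_monomE um vm.
  exact: finite_seq.
suff -> : [set u | word_monom u = m] = set0 by exact: finite_set0.
by apply/seteqP; split => u //= um; case: h; exists u.
Qed.

Lemma ssyt_fiber_finite la m :
  finite_set [set t | ssyt la t /\ word_monom (flatten t) = m].
Proof.
apply: (sub_finite_set (B := (reshape la) @` [set u | word_monom u = m])).
  move=> t [[<- _ _] tm]; exists (flatten t) => //; exact: flattenK.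
by apply: finite_image; exact: word_fiber_finite.
Qed.

Lemma finite_bounded (k n : nat) :
  finite_set [set s : seq nat | (size s <= k)%N /\ all (fun x => x <= n)%N s].
Proof.
elim: k => [|k IH].
  apply: (sub_finite_set (B := [set [::]])); last exact: finite_set1.
  by move=> [|x s] //= [].
apply: (sub_finite_set (B := [set [::]] `|`
   (fun p : nat * seq nat => p.1 :: p.2) @`
     (`I_n.+1 `*` [set s : seq nat | (size s <= k)%N /\ all (fun x => x <= n)%N s]))).
  move=> [|x s] /= [h1]; first by left.
  move=> /andP[hx hs]; right; exists (x, s) => //=.
rewrite finite_setU; split; first exact: finite_set1.
by apply: finite_image; apply: finite_setX => //; exact: finite_II.
Qed.

Lemma finite_partitions_of n : finite_set (partitions_of n).
Proof.
apply: sub_finite_set (finite_bounded n n) => la [_ pos <-] /=; split.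
  elim: la pos => //= x s IH /andP[x0 /IH h]; rewrite -add1n; exact: leq_add.
elim: la {pos} => //= x s IH; rewrite leq_addr /=.
by apply: sub_all IH => y hy; apply: leq_trans hy (leq_addl _ _).
Qed.

End Finiteness.

(* Main.v *)
(* Complementing a permutation complements its descent set, so the claim is that
   the linear map omega : F_S |-> F_(~: S) preserves symmetry and exchanges s_la
   with the Schur function of the transpose.  By inclusion-exclusion the
   coefficient of omega f at a composition al is the signed sum of the coefficients
   of f over the refinements of al.  This formula defines omega on all series, with
   no appeal to the linear independence of the F_S; and since the refinements of al
   are the concatenations of compositions of its parts, it is invariant under
   rearranging al when f is symmetric.  Finally s_la is the sum of F_(D c) over the
   linear extensions c of the diagram of la, where D c records the steps weakly to
   the left, and transposing the diagram complements D c. *)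
Require Import Defs.
From mathcomp Require Import all_boot all_algebra all_fingroup finmap.
From mathcomp Require Import boolp classical_sets functions cardinality fsbigop.
From mathcomp.multinomials Require Import monalg.
From mathcomp Require Import zify.

Set Implicit Arguments.
Unset Strict Implicit.
Unset Printing Implicit Defensive.

Import GRing.Theory.

Local Open Scope ring_scope.

(** * Monomials, sorted words and bit sequences *)

Lemma word_monom_perm (u v : seq nat) :
  word_monom u = word_monom v <-> perm_eq u v.
Proof.
split=> [e|/seq.permP e].
  by apply/allP => x _ /=; rewrite -!word_monomE e.
by apply/eqP/cmP => i; rewrite !word_monomE e.
Qed.

(* Bit [k.+1] tells whether [r] holds between entries [k] and [k.+1]; the leading
   [true] carries no information, but makes every maximal run without [r]-steps
   start exactly at a [true]. *)
Definition step_bits (T : Type) (r : rel T) (s : seq T) : bitseq :=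
  if s is x :: s' then true :: pairmap r x s' else [::].

Lemma size_step_bits (T : Type) (r : rel T) s : size (step_bits r s) = size s.
Proof. by case: s => //= x s; rewrite size_pairmap. Qed.

Lemma nth_step_bits (T : Type) (r : rel T) (x0 : T) s k : (k.+1 < size s)%N ->
  nth false (step_bits r s) k.+1 = r (nth x0 s k) (nth x0 s k.+1).
Proof.
case: s => //= x s; rewrite ltnS => ks.
by rewrite (nth_pairmap x0).
Qed.

Definition strict_bits (u : seq nat) : bitseq := step_bits ltn u.

(* With compositions read as bit sequences (one block per [true]), these are the
   refinements of the composition [y]. *)
Fixpoint up_bits (y : bitseq) : seq bitseq :=
  if y is b :: y' then
    map (cons true) (up_bits y') ++
    (if b then [::] else map (cons false) (up_bits y'))
  else [:: [::]].

Lemma big_up_bits_cat (V : nmodType) (g : bitseq -> V) y z :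
  \sum_(x <- up_bits (y ++ z)) g x =
  \sum_(x <- up_bits y) \sum_(w <- up_bits z) g (x ++ w).
Proof.
elim: y g => [|b y IH] g /=; first by rewrite big_seq1.
rewrite !big_cat !big_map /= IH; congr (_ + _).
by case: b; rewrite ?big_nil // !big_map IH.
Qed.

(** When the lengths agree, the sum factors over the positions. A position contributes 1, except
    where [s] and [y] are both [false]: there the two bits allowed in [x] carry opposite signs and
    cancel. *)
Lemma mobius_up_bits (R : nzRingType) (s y : bitseq) :
  \sum_(x <- up_bits y) (-1) ^+ count negb x * (all2 implb s x)%:R =
  (all2 implb (map negb s) y)%:R :> R.
Proof.
elim: y s => [|b y IH] [|a s] /=.
- by rewrite big_seq1 mul1r.
- by rewrite big_seq1 mulr0.
- rewrite big1_seq // => x; rewrite mem_cat => /andP[_ /orP[|]].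
    by move=> /mapP[z _ ->]; rewrite mulr0.
  by case: b => // /mapP[z _ ->]; rewrite mulr0.
rewrite big_cat big_map /=.
under eq_bigr do rewrite add0n implybT andTb.
rewrite IH; case: b; first by rewrite big_nil addr0 implybT.
rewrite big_map; case: a => /=.
  by rewrite big1 ?addr0 // => x _; rewrite mulr0.
under eq_bigr do rewrite add1n exprS mulN1r mulNr.
by rewrite sumrN IH subrr.
Qed.

Definition mword (m : {cmonom nat}) : seq nat :=
  flatten [seq nseq (m i) i | i <- sort leq (finsupp m)].

Lemma mwordK : cancel mword word_monom.
Proof.
move=> m; apply/eqP/cmP => i; rewrite word_monomE count_flatten -map_comp.
rewrite (_ : [seq _ | _ <- _] = [seq (j == i) * m j | j <- sort leq (finsupp m)])%N; last first.
  by apply: eq_map => j /=; rewrite count_nseq.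
rewrite sumnE big_map (perm_big (finsupp m)) ?perm_sort //=.
have [/fsfun_dflt mi0|im] := boolP (i \notin finsupp m).
  rewrite big_seq big1 ?mi0 // => j jm; case: eqP => // ji.
  by rewrite -ji in mi0; rewrite mi0.
rewrite negbK in im.
rewrite (bigD1_seq i) ?fset_uniq //= eqxx mul1n big1 ?addn0 // => j /negbTE ->.
by rewrite mul0n.
Qed.

(** A part 0 would still produce one bit, so only positive parts are encoded faithfully. *)
Definition blocks (al : seq nat) : bitseq :=
  flatten [seq true :: nseq k.-1 false | k <- al].

Lemma strict_bits_blocks (l : seq nat) (c : nat -> nat) :
  sorted ltn l -> (forall i, i \in l -> 0 < c i)%N ->
  let u := flatten [seq nseq (c i) i | i <- l] in
  sorted leq u /\ strict_bits u = blocks (map c l).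
Proof.
elim: l => [//|i l IH] /= il c0.
have /IH {IH} : sorted ltn l by apply: path_sorted il.
case=> [j jl|su bu]; first by apply: c0; rewrite inE jl orbT.
have := c0 i; rewrite mem_head => /(_ isT); case ci: (c i) => [|k] // _.
set u := flatten _ in su bu *.
have [pu hu] : path leq i u /\ pairmap ltn i u = strict_bits u.
  case: {il} l @u (order_path_min ltn_trans il) c0 su bu => [|j l] //= /andP[ij _] c0.
  have := c0 j; rewrite !inE eqxx orbT => /(_ isT); case: (c j) => //= k' _ pu _.
  by rewrite (ltnW ij) pu ij.
have lk : last i (nseq k i) = i by elim: (k).
have pk : path leq i (nseq k i) by elim: (k) => //= ? ->; rewrite leqnn.
have bk : pairmap ltn i (nseq k i) = nseq k false.
  by elim: (k) => //= ? ->; rewrite ltnn.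
split; first by rewrite /= cat_path lk pk.
by rewrite /= pairmap_cat lk bk hu bu.
Qed.

Lemma mword_blocks (m : {cmonom nat}) :
  sorted leq (mword m) /\
  strict_bits (mword m) = blocks (map m (sort leq (finsupp m))).
Proof.
apply: strict_bits_blocks.
  by rewrite ltn_sorted_uniq_leq sort_uniq fset_uniq sort_sorted //; exact: leq_total.
by move=> i; rewrite mem_sort mem_finsupp lt0n.
Qed.

Lemma mword_sorted m : sorted leq (mword m).
Proof. by have [] := mword_blocks m. Qed.

Lemma word_monomK (u : seq nat) : sorted leq u -> mword (word_monom u) = u.
Proof.
move=> su; apply: (sorted_eq leq_trans anti_leq (mword_sorted _) su).
by apply/word_monom_perm; rewrite mwordK.
Qed.

(** A weakly increasing word with prescribed strict ascents. [scanl] omits the seed, so a leading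
    [true] makes all letters exceed [a]. *)
Definition bits_word (a : nat) (y : bitseq) : seq nat :=
  scanl (fun a (b : bool) => a + b)%N a y.

Lemma bits_word_path a y : path leq a (bits_word a y).
Proof. by elim: y a => //= b y IH a; rewrite leq_addr IH. Qed.

Lemma strict_bits_word y : head true y -> strict_bits (bits_word 0 y) = y.
Proof.
case: y => //= -[] // y _; congr cons; apply: scanlK => a b.
by case: b; rewrite ?addn1 ?addn0 /= ?ltnS ?leqnn ?ltnn.
Qed.

Lemma bits_word_cat a y z :
  bits_word a (y ++ z) = bits_word a y ++ bits_word (a + count id y) z.
Proof. by elim: y a => [|b y IH] a /=; rewrite ?addn0 // IH addnA. Qed.

Lemma bits_word_shift k a y :
  bits_word (k + a) y = [seq (k + i)%N | i <- bits_word a y].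
Proof. by elim: y a => //= b y IH a; rewrite -addnA IH. Qed.

Lemma bits_word_le a y : {in bits_word a y, forall i, a <= i <= a + count id y}%N.
Proof.
elim: y a => //= b y IH a i; rewrite inE addnA => /predU1P[->|/IH/andP[ai ->]].
  by rewrite !leq_addr.
by rewrite (leq_trans _ ai) ?leq_addr.
Qed.

(** Hence consecutive pieces that start with [true] use disjoint intervals of letters. *)
Lemma bits_word_bound a y : head true y ->
  {in bits_word a y, forall i, a < i <= a + count id y}%N.
Proof.
case: y => //= b y -> i; rewrite addn1 inE addnA addn1 => /predU1P[->|/bits_word_le //].
by rewrite leqnn leq_addr.
Qed.

(** * The map [omega] and symmetry *)

Section Omega.
Variable R : comNzRingType.
Implicit Types (f : fpseries R) (m : {cmonom nat}).

(** This is F_S, with S marked by the bits after the first: [mword m] is the only weakly increasing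
    word with monomial [m], so every coefficient is 0 or 1. *)
Definition bits_series (x : bitseq) : fpseries R :=
  fun m => (all2 implb x (strict_bits (mword m)))%:R.

(* If [f] is the sum of [a_S F_S], the coefficient of [f] at a word with strict
   ascent set [U] is the sum of the [a_S] over [S \subset U].  Inclusion-exclusion
   turns these values into those of the sum of [a_S F_(~: S)]. *)
Definition signed_coef f (y : bitseq) : R :=
  (-1) ^+ count negb y * f (word_monom (bits_word 0 y)).

Definition omega f : fpseries R :=
  fun m => \sum_(y <- up_bits (strict_bits (mword m))) signed_coef f y.

Lemma up_bits_head y x : head true y -> x \in up_bits y -> head true x.
Proof.
case: y => [|b y] /=; first by rewrite inE => _ /eqP ->.
by move=> ->; rewrite cats0 => /mapP[z _ ->].
Qed.

(** No [y] in the sum starts with [false], so [bits_word 0 y] has strict bits exactly [y]; what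
    remains is [mobius_up_bits]. *)
Lemma omega_bits x : omega (bits_series x) = bits_series (map negb x).
Proof.
apply: funext => m; rewrite /omega /bits_series -mobius_up_bits.
rewrite big_seq [RHS]big_seq; apply: eq_bigr => y yu; rewrite /signed_coef.
have hy : head true y by apply: up_bits_head yu; case: (mword m).
rewrite /bits_series word_monomK ?strict_bits_word //.
exact: path_sorted (bits_word_path 0 y).
Qed.

Lemma omegaD : {morph omega : f g / f + g}.
Proof.
move=> f g; apply: funext => m; apply: etrans (big_split _ _ _ _ _); rewrite /omega.
by apply: eq_bigr => y _; apply: mulrDr.
Qed.

Lemma omega0 : omega 0 = 0.
Proof.
by apply: funext => m; rewrite /omega big1 // => y _; rewrite /signed_coef mulr0.
Qed.

Lemma omegaZ (a : R) f : omega (a *: f) = a *: omega f.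
Proof.
apply: funext => m; apply: etrans (esym (mulr_sumr _ _ _ _)); rewrite /omega.
by apply: eq_bigr => y _; apply: mulrCA.
Qed.

Lemma omega_sum (I : Type) (r : seq I) (P : pred I) (F : I -> fpseries R) :
  omega (\sum_(i <- r | P i) F i) = \sum_(i <- r | P i) omega (F i).
Proof. exact: (big_morph omega omegaD omega0). Qed.

(** The two words differ by the permutation of the variables that exchanges the adjacent intervals
    of letters used by [P] and [Q]. *)
Lemma symmetric_coef_swap f P Q B : symmetric_series f ->
  head true P -> head true Q -> head true B ->
  f (word_monom (bits_word 0 (P ++ Q ++ B))) =
  f (word_monom (bits_word 0 (Q ++ P ++ B))).
Proof.
move=> sf hP hQ hB.
(* The intervals start at 1, not 0, because the first bit of a nonempty piece is [true]. *)
pose sw (p q i : nat) : nat :=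
  if (0 < i <= p)%N then (q + i)%N else
  if (p < i <= p + q)%N then (i - p)%N else i.
have swK p q : cancel (sw p q) (sw q p).
  by move=> i; rewrite /sw; do 2!case: ifP; do 2?case: ifP; lia.
set p := count id P; set q := count id Q.
have bw : bijective (sw p q) by exists (sw q p); exact: swK.
apply/esym/(sf _ bw) => i; rewrite !word_monomE.
have -> : count_mem i (bits_word 0 (P ++ Q ++ B)) =
    count_mem (sw p q i) (map (sw p q) (bits_word 0 (P ++ Q ++ B))).
  by rewrite count_map; apply: eq_count => j /=; rewrite (can_eq (swK p q)).
move: (sw p q i) => k; apply: (seq.permP _ (pred1 k)); rewrite !bits_word_cat !map_cat !add0n -/p -/q.
have -> : [seq sw p q j | j <- bits_word 0 P] = bits_word q P.
  rewrite -[q in RHS]addn0 bits_word_shift; apply/eq_in_map => j.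
  by move=> /(bits_word_bound hP); rewrite add0n /sw => ->.
have -> : [seq sw p q j | j <- bits_word p Q] = bits_word 0 Q.
  rewrite -[p in LHS]addn0 bits_word_shift -map_comp -[RHS]map_id.
  apply/eq_in_map => j /(bits_word_bound hQ); rewrite add0n /sw -/q /=.
  by do 2?case: ifP; lia.
have -> : [seq sw p q j | j <- bits_word (p + q) B] = bits_word (q + p) B.
  rewrite addnC -[RHS]map_id; apply/eq_in_map => j.
  by move=> /(bits_word_bound hB); rewrite /sw; do 2?case: ifP; lia.
by rewrite perm_catCA.
Qed.

Lemma up_blocks_perm f al be : symmetric_series f -> perm_eq al be ->
  \sum_(y <- up_bits (blocks al)) signed_coef f y =
  \sum_(y <- up_bits (blocks be)) signed_coef f y.
Proof.
move=> sf; have hb al' : head true (blocks al') by case: al'.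
(* It suffices to exchange two adjacent segments. The sum splits into sums over refinements of the
   three pieces, and the sign, which counts [false] bits, ignores their order. *)
move: al be; apply: catCA_perm_subst => s1 s2 s3; rewrite /blocks !map_cat !flatten_cat.
rewrite -!/(blocks _) big_up_bits_cat [RHS]big_up_bits_cat.
under eq_bigr do rewrite big_up_bits_cat.
under [RHS]eq_bigr do rewrite big_up_bits_cat.
rewrite exchange_big /=.
apply: eq_big_seq => Q /(up_bits_head (hb _)) hQ.
apply: eq_big_seq => P /(up_bits_head (hb _)) hP.
apply: eq_big_seq => B /(up_bits_head (hb _)) hB.
rewrite /signed_coef (symmetric_coef_swap sf) // !count_cat addnCA.
by [].
Qed.

(** The strict bits of [mword m] encode the composition of nonzero exponents of [m], which a
    permutation of the variables merely rearranges. *)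
Lemma omega_symmetric f : symmetric_series f -> symmetric_series (omega f).
Proof.
move=> sf w bw m m' mw; rewrite /omega.
rewrite (mword_blocks m).2 (mword_blocks m').2; apply: up_blocks_perm => //.
have -> : map m (sort leq (finsupp m)) = map m' (map w (sort leq (finsupp m))).
  by rewrite -map_comp; apply: eq_map => i /=.
apply: perm_map; rewrite perm_sort perm_sym.
rewrite (perm_trans (perm_map w (permEl (perm_sort leq (finsupp m))))) //.
apply: uniq_perm; rewrite ?fset_uniq ?(map_inj_uniq (bij_inj bw)) ?fset_uniq //.
move=> i; case: bw => w' wK w'K.
by rewrite -{1}(w'K i) (mem_map (can_inj wK)) !mem_finsupp -mw w'K.
Qed.
End Omega.

(** * Fundamental series as bit series *)

Lemma all2_implb_step (T : Type) (x0 : T) (r : rel T) (x : bitseq) (s : seq T) :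
  reflect (size x = size s /\ forall k, (k.+1 < size s)%N ->
             nth false x k.+1 -> r (nth x0 s k) (nth x0 s k.+1))
          (all2 implb x (step_bits r s)).
Proof.
rewrite all2E size_step_bits; apply: (iffP andP) => [[/eqP xs]|[xs h]].
  have szip : size (zip x (step_bits r s)) = size s.
    by rewrite size_zip size_step_bits xs minnn.
  move=> /(all_nthP (false, false)) h; split=> // k ks.
  have := h k.+1; rewrite szip nth_zip ?size_step_bits //= => /(_ ks).
  by rewrite (nth_step_bits _ x0) // => /implyP.
rewrite xs; split=> //; apply/(all_nthP (false, false)) => k.
rewrite size_zip size_step_bits xs minnn nth_zip ?size_step_bits //=.
case: k => [|k] ks; first by case: s {xs h} ks => //= y s _; rewrite implybT.
by apply/implyP; rewrite (nth_step_bits _ x0) //; exact: h.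
Qed.

Lemma monom_sum_seq (R : nzRingType) (T : choiceType) (A : set T)
    (w : T -> {cmonom nat}) (m : {cmonom nat}) (s : seq T) :
  uniq s -> (forall t, A t /\ w t = m <-> t \in s) ->
  monom_sum R A w m = (size s)%:R.
Proof.
move=> us As; rewrite /monom_sum (_ : [set t | _]%classic = [set` s]%classic); last first.
  by apply/seteqP; split=> t /As.
by rewrite -fsbig_seq // big_const_seq count_predT iter_addr_0.
Qed.

Definition set_bits n (S : {set 'I_n}) : bitseq :=
  true :: [seq k \in S | k <- enum 'I_n].

Lemma size_set_bits n (S : {set 'I_n}) : size (set_bits S) = n.+1.
Proof. by rewrite /= size_map size_enum_ord. Qed.

Lemma nth_set_bits n (S : {set 'I_n}) (k : 'I_n) :
  nth false (set_bits S) k.+1 = (k \in S).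
Proof. by rewrite /= (nth_map k) ?size_enum_ord // nth_ord_enum. Qed.

Lemma F_indexE n (S : {set 'I_n}) (u : seq nat) :
  @F_index n.+1 S u <-> sorted leq u /\ all2 implb (set_bits S) (strict_bits u).
Proof.
split=> [[su h]|[lu /(all2_implb_step 0%N)[]]].
  split; first by apply/(sortedP 0%N) => k; rewrite su ltnS => kn; case: (h (Ordinal kn)).
  apply/(all2_implb_step 0%N); rewrite size_set_bits su; split=> // k; rewrite ltnS => kn.
  by rewrite (nth_set_bits S (Ordinal kn)) => /(proj2 (h (Ordinal kn))).
rewrite size_set_bits => su h; split=> // k; split.
  by have /(sortedP 0%N) := lu; apply; rewrite -su ltnS.
by rewrite -nth_set_bits; apply: h; rewrite -su ltnS.
Qed.

Section BitsSeries.
Variable R : comNzRingType.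

(** The strict bits of a nonempty word start with [true], which every bit implies. This absorbs the
    leading [false] created by negating a bit sequence. *)
Lemma bits_series_head a b x : bits_series R (a :: x) = bits_series R (b :: x).
Proof.
apply: funext => m; rewrite /bits_series; case: (mword m) => //= i u.
by rewrite !implybT.
Qed.

Lemma fundamental_bits n (S : {set 'I_n}) :
  @fundamental R n.+1 S = bits_series R (set_bits S).
Proof.
apply: funext => m; rewrite /fundamental /bits_series.
pose b := all2 implb (set_bits S) (strict_bits (mword m)).
(* The fibre over [m] contains at most [mword m], so this list has one word or none. *)
rewrite -/b (@monom_sum_seq _ _ _ _ _ (nseq b (mword m))).
- by rewrite size_nseq.
- by case: b.
move=> u; split=> [[/F_indexE[su bu] um]|].
  have mu : mword m = u by rewrite -um word_monomK.
  by rewrite mem_nseq /b mu bu /=.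
rewrite mem_nseq lt0b => /andP[bT /eqP ->].
split; last exact: mwordK.
by apply/F_indexE; split=> //; apply: mword_sorted.
Qed.
End BitsSeries.

(** * Descents, patterns and the complement *)

Lemma nth_oneline n (s : 'S_n) (k : 'I_n) : nth 0%N (oneline s) k = s k.
Proof. by rewrite (nth_map k) ?size_enum_ord // nth_ord_enum. Qed.

Lemma size_oneline n (s : 'S_n) : size (oneline s) = n.
Proof. by rewrite size_map size_enum_ord. Qed.

Lemma set_bits_Des n (s : 'S_n.+1) :
  set_bits (Des s) = step_bits gtn (oneline s).
Proof.
apply: (@eq_from_nth _ false).
  by rewrite size_set_bits size_step_bits size_oneline.
rewrite size_set_bits => -[_|k kn].
  by case: (oneline s) (size_oneline s).
rewrite (nth_step_bits _ 0%N) ?size_oneline //.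
by rewrite (nth_set_bits (Des s) (Ordinal (kn : k < n)%N)) inE.
Qed.

Lemma perm_complE n (s : 'S_n) i : perm_compl s i = rev_ord (s i).
Proof. by rewrite permE. Qed.

Lemma perm_complK n : involutive (@perm_compl n).
Proof. by move=> s; apply/permP => i; rewrite !perm_complE rev_ordK. Qed.

(** Adjacent values are distinct, so reversing their order flips every bit but the conventional
    first one; hence [behead]. *)
Lemma step_bits_compl n (s : 'S_n.+1) :
  behead (step_bits gtn (oneline (perm_compl s))) =
  behead (map negb (step_bits gtn (oneline s))).
Proof.
apply: (@eq_from_nth _ false).
  by rewrite !size_behead size_map !size_step_bits !size_oneline.
move=> k; rewrite size_behead size_step_bits size_oneline /= => kn.
rewrite !nth_behead (nth_map false) ?size_step_bits ?size_oneline //.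
rewrite !(nth_step_bits _ 0%N) ?size_oneline //.
pose i : 'I_n.+1 := Ordinal (ltnW (kn : k.+1 < n.+1)%N).
pose j : 'I_n.+1 := Ordinal (kn : k.+1 < n.+1)%N.
rewrite !(nth_oneline _ i) !(nth_oneline _ j) !perm_complE /=.
have : s i != s j by rewrite (inj_eq perm_inj) -val_eqE /= neq_ltn ltnSn.
rewrite -val_eqE /=; move: (ltn_ord (s i)) (ltn_ord (s j)).
by move: (val (s i)) (val (s j)) => a b; lia.
Qed.

(** The same positions serve: both value orders are reversed, so the pair (i, j) uses the hypothesis
    at (j, i). *)
Lemma contains_compl n m (s : 'S_n) (p : 'S_m) :
  contains (perm_compl s) (perm_compl p) = contains s p.
Proof.
have aux n' m' (s' : 'S_n') (p' : 'S_m') : contains s' p' ->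
    contains (perm_compl s') (perm_compl p').
  move=> /existsP[f /andP[fm /forallP fp]]; apply/existsP; exists f; rewrite fm /=.
  apply/forallP => i; apply/forallP => j; have /forallP/(_ i) := fp j.
  by rewrite !perm_complE /= !ltn_sub2lE.
apply/idP/idP; last exact: aux.
by move=> /aux; rewrite !perm_complK.
Qed.

Lemma avoiders_compl n (Pi : permset) :
  avoiders n (permset_compl Pi) = [set perm_compl s | s in avoiders n Pi]%SET.
Proof.
apply/setP => s; rewrite inE -{2}(perm_complK s).
rewrite (mem_imset _ _ (can_inj (@perm_complK n))) inE.
apply: asbool_equiv_eq; split=> h m p pPi.
  by rewrite -(perm_complK p) contains_compl h // mem_imset //; apply: can_inj (@perm_complK m).
move: pPi => /imsetP[q qPi ->].
by rewrite -(perm_complK s) contains_compl h.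
Qed.

Lemma Qpat_compl (R : comNzRingType) n (Pi : permset) :
  Qpat R n.+1 (permset_compl Pi) = omega (Qpat R n.+1 Pi).
Proof.
rewrite /Qpat avoiders_compl omega_sum big_imset /=; last first.
  by move=> s t _ _; apply: can_inj (@perm_complK _) _ _.
apply: eq_bigr => s _; rewrite !fundamental_bits omega_bits !set_bits_Des.
have := step_bits_compl s.
case: (step_bits gtn (oneline s)) (size_step_bits gtn (oneline s)) => [|b x].
  by rewrite size_oneline.
case: (step_bits _ _) (size_step_bits gtn (oneline (perm_compl s))) => [|c y].
  by rewrite size_oneline.
by move=> _ _ /= ->; apply: bits_series_head.
Qed.

(** * Linear extensions of a diagram *)

Definition cells (la : seq nat) : seq (nat * nat) :=
  [seq (i, j) | i <- iota 0 (size la), j <- iota 0 (nth 0%N la i)].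

Definition entry (t : seq (seq nat)) (p : nat * nat) : nat :=
  nth 0%N (nth [::] t p.1) p.2.

Definition cell_le (p q : nat * nat) : bool := (p.1 <= q.1)%N && (p.2 <= q.2)%N.

(** For a partition these are the standard Young tableaux, each given as its cells in the order of
    their entries. *)
Definition lin_exts (la : seq nat) : seq (seq (nat * nat)) :=
  [seq c <- permutations (cells la) | pairwise (fun p q => ~~ cell_le q p) c].

(** On consecutive cells of a linear extension of a partition this is the usual descent of a
    standard tableau: the next cell lies in a strictly lower row. *)
Definition col_weak (p q : nat * nat) : bool := (q.2 <= p.2)%N.

Lemma mem_cells la p : (p \in cells la) = (p.2 < nth 0%N la p.1)%N.
Proof.
apply/allpairsPdep/idP => [[i [j [_]]]|pla].
  by rewrite mem_iota => jla ->.
exists p.1, p.2; rewrite !mem_iota /= !add0n -surjective_pairing; split=> //.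
by rewrite ltnNge; apply/negP => /(nth_default 0%N) la0; rewrite la0 in pla.
Qed.

Lemma cells_uniq la : uniq (cells la).
Proof.
apply: allpairs_uniq_dep => [|i _|]; rewrite ?iota_uniq //.
by move=> [i j] [i' j'] _ _ [-> ->].
Qed.

Lemma flatten_cells t : flatten t = map (entry t) (cells (shape t)).
Proof.
rewrite map_flatten -map_comp size_map -[in LHS](mkseq_nth [::] t); congr flatten.
apply: eq_map => i /=; rewrite -map_comp nth_shape.
by rewrite -[LHS](mkseq_nth 0%N).
Qed.

Lemma mem_lin_exts la c :
  (c \in lin_exts la) =
  pairwise (fun p q => ~~ cell_le q p) c && perm_eq c (cells la).
Proof. by rewrite mem_filter mem_permutations. Qed.

Lemma lin_ext_perm la c : c \in lin_exts la -> perm_eq c (cells la).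
Proof. by rewrite mem_lin_exts => /andP[]. Qed.

Lemma lin_ext_lt la c p q : c \in lin_exts la ->
  p \in cells la -> q \in cells la -> cell_le p q -> p != q ->
  (index p c < index q c)%N.
Proof.
rewrite mem_lin_exts => /andP[/(pairwiseP (0, 0)%N) cP /perm_mem cc].
rewrite -!cc => pc qc pq; apply: contraNltn; rewrite leq_eqVlt => /predU1P[e|h].
  by rewrite -(nth_index (0, 0)%N pc) -e nth_index.
have := cP (index q c) (index p c); rewrite !inE !index_mem => /(_ qc pc h).
by rewrite !nth_index // pq.
Qed.

(** Equal entries of a semistandard tableau lie in distinct columns, so breaking ties by column
    orders its cells totally. *)
Definition lex_lt (f : nat * nat -> nat) (p q : nat * nat) : bool :=
  (f p < f q)%N || (f p == f q) && (p.2 < q.2)%N.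

Lemma lex_lt_trans f : transitive (lex_lt f).
Proof. by move=> q p r; rewrite /lex_lt; lia. Qed.

Lemma lex_lt_irr f : irreflexive (lex_lt f).
Proof. by move=> p; rewrite /lex_lt; lia. Qed.

Lemma sorted_lex_lt f c :
  (sorted leq (map f c) /\
   all2 implb (step_bits col_weak c) (strict_bits (map f c)))
  <-> sorted (lex_lt f) c.
Proof.
set x0 := (0, 0)%N; split=> [[/(sortedP 0%N) fc /(all2_implb_step 0%N)[_ cc]]|].
  apply/(sortedP x0) => k kc; have kc' := ltnW kc.
  have := fc k; have := cc k; rewrite size_map (nth_step_bits _ x0) //.
  by rewrite !(nth_map x0) // /lex_lt /col_weak /= => /(_ kc) h1 /(_ kc) h2; lia.
move=> /(sortedP x0) cP; split.
  apply/(sortedP 0%N) => k; rewrite size_map => kc; have := cP k kc.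
  by rewrite !(nth_map x0) ?(ltnW kc) // /lex_lt; lia.
apply/(all2_implb_step 0%N); rewrite size_step_bits size_map; split=> // k kc.
have := cP k kc; rewrite (nth_step_bits _ x0) // !(nth_map x0) ?(ltnW kc) //.
by rewrite /lex_lt /col_weak /=; lia.
Qed.

(** * Standardisation of semistandard tableaux *)

Section Shape.
Variable la : seq nat.
Hypothesis la_sorted : sorted geq la.

Lemma nth_part i i' : (i <= i')%N -> (nth 0 la i' <= nth 0 la i)%N.
Proof.
move=> ii'; case: (ltnP i' (size la)) => [i'la|/(nth_default 0%N) -> //].
have geq_tr : transitive geq by move=> a b c /= ab bc; exact: leq_trans bc ab.
by apply: (sorted_leq_nth geq_tr leqnn 0%N la_sorted); rewrite ?inE // (leq_ltn_trans ii').
Qed.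

Section Tableau.
Variable t : seq (seq nat).
Hypothesis t_ssyt : ssyt la t.

Lemma ssyt_row i j j' : (j <= j')%N -> (j' < nth 0 la i)%N ->
  (entry t (i, j) <= entry t (i, j'))%N.
Proof.
case: t_ssyt => tla rows _ jj'; rewrite -tla nth_shape /entry /= => j'i.
have ti : sorted leq (nth [::] t i).
  case: (ltnP i (size t)) => [it|/(nth_default [::]) -> //].
  by move/all_nthP : rows; apply.
by apply: (sorted_leq_nth leq_trans leqnn 0%N ti); rewrite ?inE // (leq_ltn_trans jj').
Qed.

Lemma ssyt_col i i' j : (i < i')%N -> (j < nth 0 la i')%N ->
  (entry t (i, j) < entry t (i', j))%N.
Proof.
case: t_ssyt => tla _ cols; elim: i' => // i' IH; rewrite ltnS leq_eqVlt.
have step : (j < nth 0 la i'.+1 -> entry t (i', j) < entry t (i'.+1, j))%N.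
  by rewrite -tla nth_shape; exact: cols.
move=> /predU1P[->//|ii'] ji'; apply: ltn_trans (step ji').
by apply: IH => //; apply: leq_trans ji' (nth_part (leqnSn _)).
Qed.

(** Go along the row of [p] to the column of [q], then down; the corner lies in the diagram because
    the parts are nonincreasing. *)
Lemma ssyt_cell_le p q : q \in cells la -> cell_le p q ->
  (entry t p <= entry t q)%N /\ ((p.1 < q.1) -> entry t p < entry t q)%N.
Proof.
case: p q => [i j] [i' j']; rewrite mem_cells /cell_le /= => qla /andP[ii' jj'].
have row : (entry t (i, j) <= entry t (i, j'))%N.
  by apply: ssyt_row => //; apply: leq_trans qla (nth_part ii').
case: (ltngtP i i') ii' => // [lii'|<-] _; last by rewrite row.
have col := leq_ltn_trans row (ssyt_col lii' qla).
by rewrite col (ltnW col).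
Qed.
End Tableau.

Definition fill (u : seq nat) (c : seq (nat * nat)) : seq (seq nat) :=
  [seq [seq nth 0%N u (index (i, j) c) | j <- iota 0 (nth 0%N la i)]
     | i <- iota 0 (size la)].

Lemma shape_fill u c : shape (fill u c) = la.
Proof.
rewrite /shape -map_comp -[RHS](mkseq_nth 0%N); apply: eq_map => i /=.
by rewrite size_map size_iota.
Qed.

Lemma entry_fill u c p : p \in cells la -> entry (fill u c) p = nth 0%N u (index p c).
Proof.
rewrite mem_cells /entry => pla.
have p1 : (p.1 < size la)%N.
  by rewrite ltnNge; apply/negP => /(nth_default 0%N) la0; rewrite la0 in pla.
rewrite (nth_map 0%N) ?size_iota // nth_iota // add0n (nth_map 0%N) ?size_iota //.
by rewrite nth_iota // add0n -surjective_pairing.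
Qed.

Lemma map_entry_fill u c : perm_eq c (cells la) -> size c = size u ->
  map (entry (fill u c)) c = u.
Proof.
move=> cc cu; apply: (@eq_from_nth _ 0%N); rewrite size_map // => k kc.
rewrite (nth_map (0, 0)%N) // entry_fill -?(perm_mem cc) ?mem_nth //.
by rewrite index_uniq // (perm_uniq cc) cells_uniq.
Qed.

(* Standardisation: the pairs (linear extension, compatible sorted word) are in
   bijection with the semistandard tableaux; the inverse of [fill] sorts the cells
   by entry, then by column. *)
Definition compatible (u : seq nat) : seq (seq (nat * nat)) :=
  [seq c <- lin_exts la | all2 implb (step_bits col_weak c) (strict_bits u)].

Lemma compatibleP u c : sorted leq u -> c \in compatible u ->
  [/\ c \in lin_exts la, map (entry (fill u c)) c = u
    & sorted (lex_lt (entry (fill u c))) c].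
Proof.
move=> su; rewrite mem_filter => /andP[cu cla].
have cc := lin_ext_perm cla.
have fc : map (entry (fill u c)) c = u.
  apply: map_entry_fill => //; case/(all2_implb_step 0%N): cu => <- _.
  by rewrite size_step_bits.
by split=> //; apply/sorted_lex_lt; rewrite fc.
Qed.

(** The tableau determines [c], the only listing of its cells that increases for the strict order
    [lex_lt]. *)
Lemma fill_inj u : sorted leq u -> {in compatible u &, injective (fill u)}.
Proof.
move=> su c c' /(compatibleP su)[cla _ sc] /(compatibleP su)[c'la _ sc'] e.
apply: (irr_sorted_eq (@lex_lt_trans _) (@lex_lt_irr _) sc); first by rewrite e.
by move=> p; rewrite (perm_mem (lin_ext_perm cla)) (perm_mem (lin_ext_perm c'la)).
Qed.

Lemma fill_ssyt u c : sorted leq u -> c \in compatible u ->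
  ssyt la (fill u c) /\ perm_eq (flatten (fill u c)) u.
Proof.
move=> su /(compatibleP su)[cla fc sc].
have cc := lin_ext_perm cla.
(* Along a row [lex_lt] gives weak increase; down a column the tie-break cannot apply, so the
   increase is strict. *)
have lexP p q : q \in cells la -> cell_le p q -> p != q ->
    lex_lt (entry (fill u c)) p q.
  move=> qla pq npq.
  have pla : p \in cells la.
    move: qla pq; rewrite !mem_cells => qla /andP[h1 h2].
    exact: leq_ltn_trans h2 (leq_trans qla (nth_part h1)).
  have := lin_ext_lt cla pla qla pq npq.
  have := sorted_ltn_nth (@lex_lt_trans _) (0, 0)%N sc.
  move=> /(_ (index p c) (index q c)); rewrite !inE !index_mem !(perm_mem cc).
  by rewrite !nth_index ?(perm_mem cc) // => h; apply: h.
split; last by rewrite flatten_cells shape_fill -[X in perm_eq _ X]fc perm_map // perm_sym.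
split; first exact: shape_fill.
  apply/(all_nthP [::]) => i; rewrite size_map size_iota => ila.
  apply/(sortedP 0%N) => j; rewrite -nth_shape shape_fill => jla.
  have := lexP (i, j) (i, j.+1).
  rewrite mem_cells /cell_le /= jla !leqnn leqnSn xpair_eqE eqxx ltn_eqF // /lex_lt /entry /=.
  by move=> /(_ isT isT isT); lia.
move=> i j; rewrite -nth_shape shape_fill => jla.
have := lexP (i, j) (i.+1, j).
rewrite mem_cells /cell_le /= jla !leqnn leqnSn xpair_eqE eqxx ltn_eqF // /lex_lt /entry /=.
by move=> /(_ isT isT isT); lia.
Qed.

Lemma ssyt_fill u t : sorted leq u -> ssyt la t -> perm_eq (flatten t) u ->
  t \in map (fill u) (compatible u).
Proof.
move=> su t_ssyt tu; have tla : shape t = la by case: t_ssyt.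
(* Sorting needs a total relation on all pairs. On distinct cells of [la] this one agrees with
   [lex_lt], by strictness of columns. *)
pose lex_le p q := (entry t p < entry t q)%N ||
  (entry t p == entry t q) && (p.2 <= q.2)%N.
have le_tot : total lex_le by move=> p q; rewrite /lex_le; lia.
have le_tr : transitive lex_le by move=> p q r; rewrite /lex_le; lia.
pose c := sort lex_le (cells la).
have cc : perm_eq c (cells la) by rewrite perm_sort.
have ltc : pairwise (lex_lt (entry t)) c.
  have : pairwise [rel p q | lex_le p q && (p != q)] c.
    rewrite pairwise_relI -uniq_pairwise sort_uniq cells_uniq andbT.
    by rewrite -sorted_pairwise // sort_sorted.
  apply: sub_in_pairwise (allss c) => -[i j] [i' j'] /=.
  rewrite !(perm_mem cc) !mem_cells /lex_lt /lex_le xpair_eqE /= => pc qc.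
  have [jj'|jj'] := eqVneq j j'; last by lia.
  rewrite -{}jj' in qc *; case: (ltngtP i i') => [ii'|i'i|_]; last by rewrite andbF.
    by rewrite (ssyt_col t_ssyt ii' qc).
  by have := ssyt_col t_ssyt i'i pc; lia.
have slt : sorted (lex_lt (entry t)) c by rewrite sorted_pairwise //; exact: lex_lt_trans.
have [slec cuc] := (sorted_lex_lt (entry t) c).2 slt.
have cu : map (entry t) c = u.
  apply: (sorted_eq leq_trans anti_leq slec su).
  by rewrite (perm_trans _ tu) // flatten_cells tla perm_map.
have cla : c \in lin_exts la.
  rewrite mem_lin_exts cc andbT; apply: sub_in_pairwise (allss c) ltc => p q.
  rewrite !(perm_mem cc) => pc qc; rewrite /lex_lt => pq; apply/negP => qp.
  have [] := ssyt_cell_le t_ssyt pc qp; move: qp; rewrite /cell_le; lia.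
apply/mapP; exists c; first by rewrite mem_filter cla -cu cuc.
apply: (@eq_from_nth _ [::]).
  by rewrite -(size_map size) -(size_map size (fill u c)) -/(shape _) -/(shape (fill _ _)) tla shape_fill.
move=> i _; apply: (@eq_from_nth _ 0%N); first by rewrite -!nth_shape tla shape_fill.
move=> j; rewrite -nth_shape tla => jla.
have ijc : (i, j) \in cells la by rewrite mem_cells.
have := entry_fill u c ijc; rewrite /entry /= => ->.
by rewrite -cu (nth_map (0, 0)%N) ?nth_index ?index_mem ?(perm_mem cc).
Qed.

(** The coefficient at [m] counts the tableaux whose entries rearrange [mword m]; [fill] matches
    them with the linear extensions compatible with that word, which are the terms equal to 1. *)
Lemma schur_bits (R : comNzRingType) :
  schur R la = \sum_(c <- lin_exts la) bits_series R (step_bits col_weak c).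
Proof.
apply: funext => m; rewrite fct_sumE /bits_series.
have sm := mword_sorted m.
rewrite /schur (@monom_sum_seq _ _ _ _ _ (map (fill (mword m)) (compatible (mword m)))).
- by rewrite size_map size_filter -sum1_count natr_sum big_mkcond /=; apply: eq_bigr => c _; case: ifP.
- by rewrite (map_inj_in_uniq (fill_inj sm)) !filter_uniq ?permutations_uniq.
move=> t; rewrite -{1}(mwordK m) word_monom_perm; split=> [[]|]; first exact: ssyt_fill.
by case/mapP => c cu ->; exact: fill_ssyt.
Qed.

(** * Transposing partitions and diagrams *)

Lemma count_part i j : (i < count (fun k => j < k) la)%N = (j < nth 0 la i)%N.
Proof.
have := @nth_part; move: i j; elim: la => [|x s IH] i j h.
  by rewrite nth_nil.
have {}IH := IH _ _ (fun a b ab => h a.+1 b.+1 ab).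
(* The parts greater than [j] form an initial segment: if the first part is at most [j], so are all
   others and both sides fail. *)
case: (ltnP j x) => jx; first by case: i => [|i] /=; rewrite jx // add1n ltnS IH.
have le_j k : (nth 0 (x :: s) k <= j)%N by exact: leq_trans (h 0%N k (leq0n k)) jx.
rewrite /= (ltnNge j x) jx add0n [RHS]ltnNge le_j.
rewrite (@eq_in_count _ _ pred0) ?count_pred0 // => k /(nthP 0%N)[l _ <-].
by rewrite ltnNge (le_j l.+1).
Qed.

Lemma nth_part_transpose j : nth 0%N (part_transpose la) j = count (fun k => j < k)%N la.
Proof.
rewrite /part_transpose; case: (ltnP j (head 0%N la)) => jla; first by rewrite nth_mkseq.
rewrite nth_default ?size_mkseq //; apply/esym/eqP; rewrite -leqn0 leqNgt count_part.
by rewrite nth0 -leqNgt.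
Qed.

Lemma part_transpose_sorted : sorted geq (part_transpose la).
Proof.
apply/(sortedP 0%N) => j _ /=; rewrite !nth_part_transpose.
by apply: sub_count => k; exact: ltnW.
Qed.

Lemma mem_cells_transpose p : (p \in cells (part_transpose la)) = (swap_pair p \in cells la).
Proof. by rewrite !mem_cells nth_part_transpose count_part. Qed.
End Shape.

Lemma map_swap_lin_exts la c : sorted geq la ->
  (map swap_pair c \in lin_exts (part_transpose la)) = (c \in lin_exts la).
Proof.
move=> la_sorted; rewrite !mem_lin_exts pairwise_map; congr (_ && _).
  by apply: eq_pairwise => p q; rewrite /= /cell_le andbC.
have sw_inj := can_inj (@swap_pairK nat nat).
have sw : perm_eq (cells (part_transpose la)) (map swap_pair (cells la)).
  apply: uniq_perm; rewrite ?(map_inj_uniq sw_inj) ?cells_uniq // => -[i j].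
  by rewrite mem_cells_transpose // (mem_map sw_inj (cells la) (j, i)).
by rewrite (permPr sw); apply/idP/idP => [/(perm_map_inj sw_inj)|/perm_map].
Qed.

(* The next cell cannot be weakly north-west of the current one, nor strictly
   south-east of it: in the latter case the north-east corner of the rectangle
   that they span would have to come strictly between them. *)
Lemma step_bits_transpose la c : sorted geq la -> c \in lin_exts la ->
  behead (step_bits col_weak (map swap_pair c)) =
  behead (map negb (step_bits col_weak c)).
Proof.
move=> la_sorted cla; set x0 := (0, 0)%N; have cc := lin_ext_perm cla.
apply: (@eq_from_nth _ false).
  by rewrite !size_behead size_map !size_step_bits size_map.
move=> k; rewrite size_behead size_step_bits size_map => kc.
have {}kc : (k.+1 < size c)%N by case: (size c) kc.
rewrite !nth_behead (nth_map false) ?size_step_bits //.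
rewrite !(nth_step_bits _ x0) ?size_map // !(nth_map x0) ?(ltnW kc) // /col_weak /=.
set p := nth x0 c k; set q := nth x0 c k.+1.
have pc : p \in cells la by rewrite -(perm_mem cc) mem_nth ?(ltnW kc).
have qc : q \in cells la by rewrite -(perm_mem cc) mem_nth.
have uc : uniq c by rewrite (perm_uniq cc) cells_uniq.
have ip : index p c = k by rewrite index_uniq ?(ltnW kc).
have iq : index q c = k.+1 by rewrite index_uniq.
have nqp : ~~ cell_le q p.
  move: cla; rewrite mem_lin_exts => /andP[/(pairwiseP x0) + _].
  by apply; rewrite ?inE ?(ltnW kc).
have [pq|npq] := boolP ((p.1 < q.1)%N && (p.2 < q.2)%N); last first.
  by move: nqp npq; rewrite /cell_le; lia.
have /andP[pq1 pq2] := pq.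
pose r := (p.1, q.2).
have rc : r \in cells la.
  by move: qc; rewrite !mem_cells => /leq_trans -> //; rewrite nth_part // ltnW.
have pr : p != r by rewrite /r; apply: contraTneq pq2 => ->; rewrite ltnn.
have rq : r != q by rewrite /r; apply: contraTneq pq1 => <-; rewrite ltnn.
have := lin_ext_lt cla pc rc; have := lin_ext_lt cla rc qc.
rewrite ip iq /cell_le /= !leqnn (ltnW pq1) (ltnW pq2) => /(_ isT rq) h1 /(_ isT pr) h2.
by rewrite ltnS leqNgt h2 in h1.
Qed.

Lemma schur_transpose (R : comNzRingType) la : sorted geq la ->
  schur R (part_transpose la) = omega (schur R la).
Proof.
move=> la_sorted; rewrite !schur_bits //; last exact: part_transpose_sorted.
have sw_inj := can_inj (@swap_pairK nat nat).
rewrite omega_sum (perm_big (map (map swap_pair) (lin_exts la))) /=; last first.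
  apply: uniq_perm; rewrite ?(map_inj_uniq (inj_map sw_inj)).
  - by rewrite filter_uniq // permutations_uniq.
  - by rewrite filter_uniq // permutations_uniq.
  move=> c; rewrite -(mapK (@swap_pairK nat nat) c) map_swap_lin_exts //.
  by rewrite mem_map //; exact: inj_map.
rewrite big_map; apply: eq_big_seq => c cla; rewrite omega_bits.
have := step_bits_transpose la_sorted cla.
by case: c {cla} => //= p c ->; exact: bits_series_head.
Qed.

Theorem proposition2p1 (R : comNzRingType) (Pi : permset) (n : nat)
    (n_gt0 : (0 < n)%N) :
  (symmetric_series (Qpat R n Pi) ->
   symmetric_series (Qpat R n (permset_compl Pi)))
  /\
  (forall c : seq nat -> R,
     Qpat R n Pi = \sum_(la \in partitions_of n) c la *: schur R la ->
     Qpat R n (permset_compl Pi) =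
       \sum_(la \in partitions_of n) c la *: schur R (part_transpose la)).
Proof.
(* With the length a successor, descents are indexed by ['I_n], the form that [set_bits] expects. *)
case: n n_gt0 => // n _; rewrite Qpat_compl; split; first exact: omega_symmetric.
move=> c ->; rewrite !(fsbig_finite _ _ (finite_partitions_of _)) omega_sum.
apply: eq_big_seq => la; rewrite in_fset_set; last exact: finite_partitions_of.
by rewrite inE => -[la_sorted _ _]; rewrite omegaZ schur_transpose.
Qed.
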